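(* Let $k$ be an index set, let $T$ be a finitely aligned $k$-semigraph such that every element of $T^{(0)}$ is idempotent, let $X$ be the freely generated semigraph algebra associated to $T$, and let $\Delta=T\sqcup\Delta_\mu$ be the associated semimultiplicative set. Then there is a $*$-representation $$\varphi: X \longrightarrow C^*_{r}(\Delta)\quad\text{with}\quad \varphi(t)= \lambda_t \ \text{ for all } t\in T.$$
   Context: A semimultiplicative set is a set $T$ with a subset $T^{\{2\}}\subseteq T\times T$ and a multiplication $T^{\{2\}}\to T$, $(s,t)\mapsto st$, that is associative: for all $s,t,u\in T$, $(st)u$ is defined if and only if $s(tu)$ is defined, and both are equal if defined. Let $k$ be an index set (a natural number if finite). A $k$-semigraph is a semimultiplicative set $T$ with a degree map $d:T\to\mathbb{N}_0^k$ such that (1) $d(xy)=d(x)+d(y)$ whenever $xy$ is defined, and (2) whenever $d(x)=n_1+n_2$ with $n_1,n_2\in\mathbb{N}_0^k$ there are unique $x_1,x_2\in T$ with $x=x_1x_2$, $d(x_1)=n_1$, $d(x_2)=n_2$. $T^{(n)}$ is the set of elements of degree $n$. For $s,t\in T$ write $s\le t$ if $\alpha s=t$ for some $\alpha\in T$. With $\vee$ the coordinatewise maximum, put $$T^{(\min)}(x,y)=\{(\alpha,\beta)\in T\times T \mid x\alpha,\ y\beta \text{ are defined},\ x\alpha=y\beta,\ d(x\alpha)=d(x)\vee d(y)\};$$ $T$ is finitely aligned if all these sets are finite. In a $*$-algebra (an algebra over $\mathbb{C}$ with involution), $s$ is a partial isometry if $ss^*s=s$, a projection is $p=p^2=p^*$,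 and $P_a=aa^*$, $Q_a=a^*a$. The freely generated semigraph algebra $X$ associated to $T$ is the universal $*$-algebra generated by the set $T$ subject to: (i) each element of $T$ is a partial isometry; (ii) each element of $T^{(0)}$ is a projection; (iii) if $xy=z$ in $T$ then $xy=z$ in $X$; (iv) $xy=0$ in $X$ for all $x,y\in T$ whose product in $T$ is undefined; (v) $Q_x$ and $Q_y$ commute for all $x,y\in T$; (vi) $x^*y=\sum_{(e,f)\in T^{(\min)}(x,y)} e\,Q_{yf}\,f^*$ for all $x,y\in T$. Denote an element $(y,\alpha_1,\ldots,\alpha_n)\in T^{n+1}$ ($n\ge1$) symbolically by $y\mu_{\alpha_1,\ldots,\alpha_n}$ or $y\mu_\alpha$. Put $$\Delta_\mu=\{y\mu_{\alpha_1,\ldots,\alpha_n}\mid n\in\mathbb{N},\ y,\alpha_i\in T,\ \exists i\in\{1,\ldots,n\}: y\le\alpha_i\},\qquad \Delta=T\sqcup\Delta_\mu.$$ The multiplication of $\Delta$ is that of $T$ for products within $T$ (as far as defined), and $x(y\mu_\alpha)=(xy)\mu_\alpha$ if $x\in T$, $y\mu_\alpha\in\Delta_\mu$, $xy$ is defined and $(xy)\mu_\alpha\in\Delta_\mu$; no other products are defined. This makes $\Delta$ a semimultiplicative set with left cancellation ($st_1=st_2$ implies $t_1=t_2$). For a semimultiplicative set $G$ with left cancellation define $\lambda:G\to B(\ell^2(G))$ by $\lambda_s\big(\sum_{t\in G}\alpha_t\delta_t\big)=\sum_{t\in G,\ st \text{ defined}}\alpha_t\delta_{st}$. The left reduced $C^*$-algebra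 $C^*_r(G)$ is the sub-$C^*$-algebra of $B(\ell^2(G))$ generated by $\lambda(G)$. *)

(* Defs.v *)
From HB Require Import structures.
From mathcomp Require Import all_boot all_order all_algebra generic_quotient.
From mathcomp Require Import complex ring lra.
From mathcomp Require Import boolp classical_sets functions cardinality fsbigop.
From mathcomp Require Import reals constructive_ereal ereal numfun esum.

Set Implicit Arguments.
Unset Strict Implicit.
Unset Printing Implicit Defensive.

Import Order.TTheory GRing.Theory Num.Theory.
Import ComplexField.Normc.
Local Open Scope quotient_scope.
Local Open Scope ring_scope.
Local Open Scope classical_set_scope.
Local Open Scope complex_scope.

(* [pmul s t = None] means that the product [s t] is undefined.  [pmulA] is an
   equation in [option T], so it also says that one side is defined if and only
   if the other is. *)
HB.mixin Record isSemimult T of Choice T := {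
  pmul : T -> T -> option T;
  pmulA : forall s t u : T,
    obind (fun st => pmul st u) (pmul s t) = obind (pmul s) (pmul t u)
}.
#[short(type="semimultType")]
HB.structure Definition Semimult := {T of isSemimult T & Choice T}.

HB.mixin Record isLeftCancellative T of Semimult T := {
  pmulI : forall s t1 t2 u : T,
    pmul s t1 = Some u -> pmul s t2 = Some u -> t1 = t2
}.
#[short(type="lcSemimultType")]
HB.structure Definition LCSemimult :=
  {T of isLeftCancellative T & Semimult T}.

Definition sle (T : semimultType) (s t : T) : Prop :=
  exists a : T, pmul a s = Some t.

(* Degrees are arbitrary functions [k -> nat].  For infinite [k] this includes
   the finitely supported reading of N^k, because summands of a finitely
   supported degree are finitely supported. *)
HB.mixin Record isSemigraph (k : Type) T of Semimult T := {
  deg : T -> k -> nat;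
  degM : forall x y z : T, pmul x y = Some z ->
    deg z = (fun i => (deg x i + deg y i)%N);
  deg_factor : forall (x : T) (n1 n2 : k -> nat),
    deg x = (fun i => (n1 i + n2 i)%N) ->
    exists! p : T * T,
      [/\ pmul p.1 p.2 = Some x, deg p.1 = n1 & deg p.2 = n2]
}.
#[short(type="semigraphType")]
HB.structure Definition Semigraph (k : Type) :=
  {T of isSemigraph k T & Semimult T}.

Section SemigraphDefs.
Variables (k : Type) (T : semigraphType k).

Definition degree_zero : set T := [set t | deg t = fun=> 0%N].

Definition Tmin (x y : T) : set (T * T) :=
  [set p | exists z : T, [/\ pmul x p.1 = Some z, pmul y p.2 = Some z
    & deg z = (fun i => maxn (deg x i) (deg y i))]].

Definition finitely_aligned : Prop := forall x y : T, finite_set (Tmin x y).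

End SemigraphDefs.

Arguments degree_zero {k} T.
Arguments finitely_aligned {k} T.

Lemma semigraph_pmulI (k : Type) (T : semigraphType k) (s t1 t2 u : T) :
  pmul s t1 = Some u -> pmul s t2 = Some u -> t1 = t2.
Proof.
move=> st1 st2.
have d1 := degM _ _ _ st1; have d2 := degM _ _ _ st2.
have d12 : deg t2 = deg t1.
  apply/funext => i; have := congr1 (fun f => f i) d2.
  by rewrite d1 => /addnI.
have [p [_ up]] := deg_factor _ _ _ d1.
by have := up (s, t2) (And3 st2 erefl d12); rewrite (up (s, t1)) //; case.
Qed.

Section Delta.
Variables (k : Type) (T : semigraphType k).

(* [(y, [:: a_1; ...; a_n])] stands for y mu_{a_1,...,a_n}; the condition
   forces n >= 1. *)
Definition delta_mu : Type :=
  {w : T * seq T | `[< exists2 a, a \in w.2 & sle w.1 a >]}.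

Definition delta : Type := (T + delta_mu)%type.
HB.instance Definition _ := Choice.on delta.

Definition delta_mul (s t : delta) : option delta :=
  match s, t with
  | inl x, inl y => omap inl (pmul x y)
  | inl x, inr w =>
      obind (fun z => omap inr (insub (z, (val w).2) : option delta_mu))
            (pmul x (val w).1)
  | inr _, _ => None
  end.

Lemma delta_mulA (s t u : delta) :
  obind (fun st => delta_mul st u) (delta_mul s t) =
  obind (delta_mul s) (delta_mul t u).
Proof.
case: s t u => [x|w] [y|v] [z|u].
- rewrite /=; have := pmulA x y z.
  by case: (pmul x y) => [a|]; case: (pmul y z) => [b|] //= e;
    first [by rewrite e | by rewrite -e].
- rewrite /=; have := pmulA x y (val u).1.
  case: (pmul x y) => [a|] /=; case: (pmul y (val u).1) => [b|] //= e.
  - rewrite e.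
    case: insubP => /= [v _ -> //|nb].
    case E: (pmul x b) => [c|] //=.
    case: insubP => //= v /asboolP[a' a'u [d dc]] _.
    case/negP: nb; apply/asboolP; exists a' => //=.
    have := pmulA d x b; rewrite E /= dc.
    by case: (pmul d x) => //= f fb; exists f.
  - by rewrite e.
  - by case: insubP => //= v _ ->; rewrite -e.
- by rewrite /=; case: (pmul x (val v).1) => //= c; case: insub.
- by rewrite /=; case: (pmul x (val v).1) => //= c; case: insub.
- by rewrite /=; case: (pmul y z).
- by rewrite /=; case: (pmul y (val u).1) => //= c; case: insub.
- by [].
- by [].
Qed.

HB.instance Definition _ := isSemimult.Build delta delta_mulA.

Lemma delta_mulI (s t1 t2 u : delta) :
  pmul s t1 = Some u -> pmul s t2 = Some u -> t1 = t2.
Proof.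
rewrite /pmul /=; case: s t1 t2 => [x|w] [y1|v1] [y2|v2] //=.
- case E1: (pmul x y1) => [z1|] //= [<-].
  case E2: (pmul x y2) => [z2|] //= [e]; rewrite e in E2.
  by rewrite (semigraph_pmulI E1 E2).
- case: (pmul x y1) => [z1|] //= [<-].
  by case: (pmul x (val v2).1) => [z2|] //=; case: insub.
- case: (pmul x y2) => [z2|] //= h1 [e]; move: h1; rewrite -e.
  by case: (pmul x (val v1).1) => [z1|] //=; case: insub.
- case E1: (pmul x (val v1).1) => [z1|] //=.
  case: insubP => //= w1 _ e1 [<-].
  case E2: (pmul x (val v2).1) => [z2|] //=.
  case: insubP => //= w2 _ e2 [e]; move: e2; rewrite e e1 => -[e3 e4].
  congr inr; apply/val_inj.
  rewrite [LHS]surjective_pairing [RHS]surjective_pairing -e4; congr pair.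
  by rewrite -e3 in E2; exact: semigraph_pmulI E1 E2.
Qed.

HB.instance Definition _ := isLeftCancellative.Build delta delta_mulI.

Definition to_delta (t : T) : delta := inl t.

End Delta.

Arguments delta {k} T.

(* No unit is required. *)
HB.mixin Record isStarAlgebra (R : rcfType) A of GRing.Lmodule R[i] A := {
  smul : A -> A -> A;
  star : A -> A;
  smulA : forall x y z : A, smul x (smul y z) = smul (smul x y) z;
  smulDl : forall x y z : A, smul (x + y) z = smul x z + smul y z;
  smulDr : forall x y z : A, smul x (y + z) = smul x y + smul x z;
  smulZl : forall (c : R[i]) (x y : A), smul (c *: x) y = c *: smul x y;
  smulZr : forall (c : R[i]) (x y : A), smul x (c *: y) = c *: smul x y;
  starK : forall x : A, star (star x) = x;
  starD : forall x y : A, star (x + y) = star x + star y;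
  starZ : forall (c : R[i]) (x : A), star (c *: x) = c^* *: star x;
  starM : forall x y : A, star (smul x y) = smul (star y) (star x)
}.
#[short(type="starAlgType")]
HB.structure Definition StarAlgebra (R : rcfType) :=
  {A of isStarAlgebra R A & GRing.Lmodule R[i] A}.

Notation "x ** y" := (smul x y) (at level 40, left associativity) : ring_scope.

Section StarAlgebraDefs.
Variables (R : rcfType) (A : starAlgType R).

Definition partial_isometry (s : A) : Prop := s ** star s ** s = s.
Definition projection (p : A) : Prop := p = p ** p /\ p = star p.
Definition source_proj (a : A) : A := star a ** a.

Definition star_morphism (B : starAlgType R) (f : A -> B) : Prop :=
  [/\ linear f, forall x y, f (x ** y) = f x ** f y
    & forall x, f (star x) = star (f x)].

End StarAlgebraDefs.

Inductive star_term (R : rcfType) (G : Type) : Type :=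
| TGen of G
| TZero
| TAdd of star_term R G & star_term R G
| TOpp of star_term R G
| TScale of R[i] & star_term R G
| TMul of star_term R G & star_term R G
| TStar of star_term R G.
Arguments TZero {R G}.

HB.instance Definition _ (R : rcfType) (G : Type) := gen_eqMixin (star_term R G).
HB.instance Definition _ (R : rcfType) (G : Type) :=
  gen_choiceMixin (star_term R G).

Fixpoint star_eval (R : rcfType) (G : Type) (A : starAlgType R) (j : G -> A)
    (x : star_term R G) : A :=
  match x with
  | TGen g => j g
  | TZero => 0
  | TAdd x y => star_eval j x + star_eval j y
  | TOpp x => - star_eval j x
  | TScale c x => c *: star_eval j x
  | TMul x y => star_eval j x ** star_eval j y
  | TStar x => star (star_eval j x)
  end.

(* [sat A j] says that the family [j] of elements of [A] satisfies the given
   relations.  Two star-polynomials in the generators are identified when they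
   take the same value on every family that satisfies the relations.
   [univ_lift_morphism], [univ_lift_gen] and [univ_lift_unique] give the
   universal property; that the generators themselves satisfy the relations has
   to be checked for each [sat] (see [semigraph_gen_relations]). *)
Section Universal.
Variables (R : rcfType) (G : Type).
Variable sat : forall A : starAlgType R, (G -> A) -> Prop.
Local Notation term := (star_term R G).

Definition term_equiv (x y : term) : bool :=
  `[< forall (A : starAlgType R) (j : G -> A), sat j ->
        star_eval j x = star_eval j y >].

Lemma term_equivP : equiv_class_of term_equiv.
Proof.
split=> [x|x y|y x z].
- exact/asboolP.
- by apply/asboolP/asboolP => xy A j jP; rewrite xy.
- by move=> /asboolP xy /asboolP yz; apply/asboolP => A j jP; rewrite xy ?yz.
Qed.

Canonical term_equiv_rel := EquivRelPack term_equivP.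

Definition univ_alg : Type := {eq_quot term_equiv_rel}.
HB.instance Definition _ := Choice.on univ_alg.

Definition univ_pi (x : term) : univ_alg := \pi_univ_alg x.
Definition univ_gen (g : G) : univ_alg := univ_pi (TGen R g).

Definition univ_lift (A : starAlgType R) (j : G -> A) (p : univ_alg) : A :=
  star_eval j (repr p).

Lemma univ_lift_pi (A : starAlgType R) (j : G -> A) (x : term) :
  sat j -> univ_lift j (univ_pi x) = star_eval j x.
Proof.
move=> jP; rewrite /univ_lift /univ_pi.
have /eqmodP/asboolP : \pi_univ_alg (repr (\pi_univ_alg x)) = \pi_univ_alg x.
  exact: reprK.
exact.
Qed.

Lemma univ_ext (p q : univ_alg) :
  (forall (A : starAlgType R) (j : G -> A), sat j ->
     univ_lift j p = univ_lift j q) -> p = q.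
Proof.
by move=> pq; rewrite -(reprK p) -(reprK q); apply/eqmodP/asboolP.
Qed.

Definition univ_zero : univ_alg := univ_pi TZero.
Definition univ_add (p q : univ_alg) := univ_pi (TAdd (repr p) (repr q)).
Definition univ_opp (p : univ_alg) := univ_pi (TOpp (repr p)).
Definition univ_scale (c : R[i]) (p : univ_alg) := univ_pi (TScale c (repr p)).
Definition univ_mul (p q : univ_alg) := univ_pi (TMul (repr p) (repr q)).
Definition univ_star (p : univ_alg) := univ_pi (TStar (repr p)).

Let liftE (A : starAlgType R) (j : G -> A) (jP : sat j) :=
  ((fun p q => univ_lift_pi (TAdd (repr p) (repr q)) jP :
      univ_lift j (univ_add p q) = univ_lift j p + univ_lift j q),
   (fun p q => univ_lift_pi (TMul (repr p) (repr q)) jP :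
      univ_lift j (univ_mul p q) = univ_lift j p ** univ_lift j q),
   (fun p => univ_lift_pi (TOpp (repr p)) jP :
      univ_lift j (univ_opp p) = - univ_lift j p),
   (fun c p => univ_lift_pi (TScale c (repr p)) jP :
      univ_lift j (univ_scale c p) = c *: univ_lift j p),
   (fun p => univ_lift_pi (TStar (repr p)) jP :
      univ_lift j (univ_star p) = star (univ_lift j p)),
   (univ_lift_pi TZero jP : univ_lift j univ_zero = 0)).

Let addA : associative univ_add.
Proof. by move=> x y z; apply: univ_ext => A j jP; rewrite !(liftE jP) addrA. Qed.
Let addC : commutative univ_add.
Proof. by move=> x y; apply: univ_ext => A j jP; rewrite !(liftE jP) addrC. Qed.
Let add0 : left_id univ_zero univ_add.
Proof. by move=> x; apply: univ_ext => A j jP; rewrite !(liftE jP) add0r. Qed.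
Let addN : left_inverse univ_zero univ_opp univ_add.
Proof. by move=> x; apply: univ_ext => A j jP; rewrite !(liftE jP) addNr. Qed.

HB.instance Definition _ :=
  GRing.isZmodule.Build univ_alg addA addC add0 addN.

Let scaleA (a b : R[i]) (v : univ_alg) :
  univ_scale a (univ_scale b v) = univ_scale (a * b) v.
Proof. by apply: univ_ext => A j jP; rewrite !(liftE jP) scalerA. Qed.
Let scale1 : left_id 1 univ_scale.
Proof. by move=> x; apply: univ_ext => A j jP; rewrite !(liftE jP) scale1r. Qed.
Let scaleDr : right_distributive univ_scale +%R.
Proof.
by move=> a x y; apply: univ_ext => A j jP; rewrite !(liftE jP) scalerDr.
Qed.
Let scaleDl (v : univ_alg) :
  {morph univ_scale^~ v : a b / a + b >-> a + b}.
Proof. by move=> a b; apply: univ_ext => A j jP; rewrite !(liftE jP) scalerDl. Qed.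

HB.instance Definition _ :=
  GRing.Zmodule_isLmodule.Build R[i] univ_alg scaleA scale1 scaleDr scaleDl.

Let mulA (x y z : univ_alg) :
  univ_mul x (univ_mul y z) = univ_mul (univ_mul x y) z.
Proof. by apply: univ_ext => A j jP; rewrite !(liftE jP) smulA. Qed.
Let mulDl (x y z : univ_alg) :
  univ_mul (x + y) z = univ_mul x z + univ_mul y z.
Proof. by apply: univ_ext => A j jP; rewrite !(liftE jP) smulDl. Qed.
Let mulDr (x y z : univ_alg) :
  univ_mul x (y + z) = univ_mul x y + univ_mul x z.
Proof. by apply: univ_ext => A j jP; rewrite !(liftE jP) smulDr. Qed.
Let mulZl (c : R[i]) (x y : univ_alg) :
  univ_mul (c *: x) y = c *: univ_mul x y.
Proof. by apply: univ_ext => A j jP; rewrite !(liftE jP) smulZl. Qed.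
Let mulZr (c : R[i]) (x y : univ_alg) :
  univ_mul x (c *: y) = c *: univ_mul x y.
Proof. by apply: univ_ext => A j jP; rewrite !(liftE jP) smulZr. Qed.
Let starK_ (x : univ_alg) : univ_star (univ_star x) = x.
Proof. by apply: univ_ext => A j jP; rewrite !(liftE jP) starK. Qed.
Let starD_ (x y : univ_alg) : univ_star (x + y) = univ_star x + univ_star y.
Proof. by apply: univ_ext => A j jP; rewrite !(liftE jP) starD. Qed.
Let starZ_ (c : R[i]) (x : univ_alg) :
  univ_star (c *: x) = c^* *: univ_star x.
Proof. by apply: univ_ext => A j jP; rewrite !(liftE jP) starZ. Qed.
Let starM_ (x y : univ_alg) :
  univ_star (univ_mul x y) = univ_mul (univ_star y) (univ_star x).
Proof. by apply: univ_ext => A j jP; rewrite !(liftE jP) starM. Qed.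

HB.instance Definition _ := isStarAlgebra.Build R univ_alg
  mulA mulDl mulDr mulZl mulZr starK_ starD_ starZ_ starM_.

Lemma univ_lift_morphism (A : starAlgType R) (j : G -> A) :
  sat j -> star_morphism (univ_lift j).
Proof.
move=> jP; split=> [c p q|p q|p]; last 2 first.
- exact: (univ_lift_pi (TMul (repr p) (repr q)) jP).
- exact: (univ_lift_pi (TStar (repr p)) jP).
rewrite (univ_lift_pi (TAdd (repr (c *: p)) (repr q)) jP) /=.
by congr (_ + _); exact: (univ_lift_pi (TScale c (repr p)) jP).
Qed.

Lemma univ_lift_gen (A : starAlgType R) (j : G -> A) (g : G) :
  sat j -> univ_lift j (univ_gen g) = j g.
Proof. exact: univ_lift_pi. Qed.

Lemma univ_pi_eval (x : term) : univ_pi x = star_eval univ_gen x.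
Proof.
elim: x => //= [x <- y <-|x <-|c x <-|x <- y <-|x <-].
all: apply: univ_ext => A j jP; rewrite !(univ_lift_pi _ jP) /=.
all: by rewrite -?/(univ_lift j (univ_pi x)) -?/(univ_lift j (univ_pi y))
  !(univ_lift_pi _ jP).
Qed.

Lemma univ_lift_unique (A : starAlgType R) (j : G -> A) (f : univ_alg -> A) :
  sat j -> star_morphism f -> (forall g, f (univ_gen g) = j g) ->
  f =1 univ_lift j.
Proof.
move=> jP [flin fM fS] fj p.
have f0 : f 0 = 0 by have := flin (-1) 0 0; rewrite scaler0 addr0 scaleN1r addNr.
have fD x y : f (x + y) = f x + f y by rewrite -{1}[x]scale1r flin scale1r.
have fZ c x : f (c *: x) = c *: f x by rewrite -[c *: x]addr0 flin f0 addr0.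
rewrite -[p]reprK -/(univ_pi (repr p)) (univ_lift_pi _ jP) univ_pi_eval.
elim: (repr p) => //= [x IHx y IHy|x IHx|c x IHx|x IHx y IHy|x IHx].
- by rewrite fD IHx IHy.
- by rewrite -scaleN1r fZ IHx scaleN1r.
- by rewrite fZ IHx.
- by rewrite fM IHx IHy.
- by rewrite fS IHx.
Qed.

End Universal.

Section SemigraphAlgebra.
Variables (R : rcfType) (k : Type) (T : semigraphType k).

(* In the last relation the product [y f] is defined for every (e, f) in
   [Tmin x y], so the default value 0 is never used.  Likewise the sum is only
   meaningful when [Tmin x y] is finite. *)
Definition semigraph_relations (A : starAlgType R) (j : T -> A) : Prop :=
  [/\ (forall x, partial_isometry (j x)),
      (forall x, degree_zero T x -> projection (j x)),
      (forall x y z, pmul x y = Some z -> j x ** j y = j z)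
    & (forall x y, pmul x y = None -> j x ** j y = 0)] /\
  [/\ (forall x y, source_proj (j x) ** source_proj (j y) =
                   source_proj (j y) ** source_proj (j x))
    & (forall x y, star (j x) ** j y =
        \sum_(p \in Tmin x y)
          j p.1 ** source_proj (oapp j 0 (pmul y p.2)) ** star (j p.2))].

Definition semigraph_alg : Type := univ_alg semigraph_relations.
HB.instance Definition _ := StarAlgebra.on semigraph_alg.

Definition semigraph_gen (t : T) : semigraph_alg :=
  univ_gen semigraph_relations t.

Lemma semigraph_gen_relations :
  finitely_aligned T -> semigraph_relations semigraph_gen.
Proof.
move=> finT.
have liftP (A : starAlgType R) (j : T -> A) : semigraph_relations j ->
    [/\ forall t, univ_lift j (semigraph_gen t) = j t,
        univ_lift j (0 : semigraph_alg) = 0,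
        forall x y : semigraph_alg,
          univ_lift j (x + y) = univ_lift j x + univ_lift j y &
        (forall x y : semigraph_alg,
          univ_lift j (x ** y) = univ_lift j x ** univ_lift j y) /\
        (forall x : semigraph_alg,
          univ_lift j (star x) = star (univ_lift j x))].
  move=> jP; have [flin fM fS] := univ_lift_morphism jP.
  split=> // [t||x y]; first exact: univ_lift_gen.
    by have := flin (-1) 0 0; rewrite scaler0 addr0 scaleN1r addNr.
  by rewrite -{1}[x]scale1r flin scale1r.
split; split.
- move=> x; apply: univ_ext => A j jP; have [g0 _ _ [fM fS]] := liftP A j jP.
  by rewrite !fM fS g0; case: jP => -[jP _ _ _] _; exact: jP.
- move=> x x0; split; apply: univ_ext => A j jP;
    have [g0 _ _ [fM fS]] := liftP A j jP; rewrite ?fM ?fS !g0;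
    by case: jP => -[_ jP _ _] _; case: (jP x x0).
- move=> x y z xyz; apply: univ_ext => A j jP.
  have [g0 _ _ [fM fS]] := liftP A j jP.
  by rewrite fM !g0; case: jP => -[_ _ + _] _; apply.
- move=> x y xy; apply: univ_ext => A j jP.
  have [g0 f0 _ [fM fS]] := liftP A j jP.
  by rewrite fM f0 !g0; case: jP => -[_ _ _ +] _; apply.
- move=> x y; apply: univ_ext => A j jP.
  have [g0 _ _ [fM fS]] := liftP A j jP.
  by rewrite /source_proj !fM !fS !g0; case: jP => _ [+ _]; apply.
- move=> x y; apply: univ_ext => A j jP.
  have [g0 f0 fD [fM fS]] := liftP A j jP.
  rewrite fM fS !g0; case: (jP) => _ [_ ->].
  rewrite !(fsbig_finite _ _ (finT x y)) /=.
  rewrite (big_morph _ fD f0); apply: eq_bigr => p _.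
  rewrite !fM fS !g0 /source_proj; congr (_ ** _ ** _); last by rewrite fS g0.
  by case: (pmul y p.2) => [z|] /=; rewrite ?fM ?fS ?g0 ?f0.
Qed.

End SemigraphAlgebra.

Arguments semigraph_alg R {k} T.
Arguments semigraph_gen R {k T} t.

(* Unconditional sums of absolutely summable families, indexed by an arbitrary
   set: positive and negative parts are summed separately. *)
Definition rsum (R : realType) (I : choiceType) (h : I -> R) : R :=
  fine (\esum_(i in [set: I]) (EFin \o h)^\+%E i) -
  fine (\esum_(i in [set: I]) (EFin \o h)^\-%E i).

Definition csum (R : realType) (I : choiceType) (h : I -> R[i]) : R[i] :=
  rsum (fun i => complex.Re (h i)) +i* rsum (fun i => complex.Im (h i)).

Section Ell2.
Variables (R : realType) (G : choiceType).

Definition sqsum (f : G -> R[i]) : \bar R :=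
  \esum_(t in [set: G]) (normc (f t) ^+ 2)%:E.

Definition square_summable : {pred G -> R[i]} := fun f => (sqsum f < +oo)%E.

Lemma square_summable_closed : submod_closed square_summable.
Proof.
split=> [|c f g]; rewrite /square_summable !unfold_in /sqsum.
  by rewrite esum1 ?ltry// => t _; rewrite normc0 expr0n.
move=> fG gG.
pose n := (Num.truncn (2 * normc c ^+ 2)).+1.
apply: (@le_lt_trans _ _
  (\esum_(t in [set: G]) (\sum_(i < n) (normc (f t) ^+ 2)%:E +
                          \sum_(i < 2) (normc (g t) ^+ 2)%:E)%E)).
  apply: le_esum => t _; rewrite !sumEFin -EFinD lee_fin !sumr_const !card_ord.
  rewrite -[normc (f t) ^+ 2 *+ n]mulr_natl.
  have cn : 2 * normc c ^+ 2 <= n%:R by apply/ltW/truncnS_gt.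
  have ff : 0 <= normc (f t) ^+ 2 by exact: sqr_ge0.
  apply: (@le_trans _ _ ((normc c * normc (f t) + normc (g t)) ^+ 2)).
    have := le_normcD (c * f t) (g t); rewrite normcM => h.
    rewrite ler_sqr ?nnegrE //.
      by case: ((c *: f + g) t) => a b /=; exact: sqrtr_ge0.
    by rewrite addr_ge0 ?mulr_ge0 //; case: (f t) (g t) c {n cn h} => [? ?] [? ?] [? ?];
      exact: sqrtr_ge0.
  have := ler_wpM2r ff cn; have := sqr_ge0 (normc c * normc (f t) - normc (g t)).
  by rewrite sqrrB sqrrD exprMn !mulr2n; lra.
rewrite esumD; [|by move=> t _; apply: sume_ge0 => i _; rewrite lee_fin sqr_ge0..].
rewrite !esum_sum; [|by move=> t i _ _; rewrite lee_fin sqr_ge0..].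
by apply: lte_add_pinfty; apply: lte_sum_pinfty.
Qed.

HB.instance Definition _ :=
  GRing.isSubmodClosed.Build R[i] (G -> R[i]) square_summable
    square_summable_closed.

Record ell2 : Type := Ell2 {
  ell2_val :> G -> R[i];
  ell2P : ell2_val \in square_summable
}.
HB.instance Definition _ := [isSub for ell2_val].
HB.instance Definition _ := [Choice of ell2 by <:].
HB.instance Definition _ := [SubChoice_isSubLmodule of ell2 by <:].

Definition l2norm (f : ell2) : R := Num.sqrt (fine (sqsum f)).

(* Linear in the first argument; the family is absolutely summable. *)
Definition inner (f g : ell2) : R[i] := csum (fun t => f t * (g t)^*).

Definition bounded_op : set (ell2 -> ell2) :=
  [set A | linear A /\ exists M : R, forall f, l2norm (A f) <= M * l2norm f].

Definition opnorm (A : ell2 -> ell2) : R :=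
  inf [set M : R | 0 <= M /\ forall f, l2norm (A f) <= M * l2norm f].

Definition is_adjoint (A B : ell2 -> ell2) : Prop :=
  forall f g : ell2, inner (A f) g = inner f (B g).

(* The adjoint of a bounded operator exists by Riesz and is unique, so the last
   clause of the first conjunct is closure under the involution of B(l^2(G)).
   The second conjunct is closedness in the operator norm. *)
Definition sub_cstar_algebra (S : set (ell2 -> ell2)) : Prop :=
  [/\ S `<=` bounded_op,
      S 0,
      (forall (c : R[i]) A B, S A -> S B -> S (c *: A + B)),
      (forall A B, S A -> S B -> S (A \o B))
    & (forall A B, S A -> bounded_op B -> is_adjoint A B -> S B)] /\
  (forall A, bounded_op A ->
     (forall e : R, 0 < e -> exists2 B, S B & opnorm (A - B) < e) -> S A).

Definition star_representation (X : starAlgType R) (phi : X -> ell2 -> ell2) :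
    Prop :=
  [/\ linear phi, forall x y, phi (x ** y) = phi x \o phi y
    & forall x, is_adjoint (phi x) (phi (star x))].

End Ell2.

Section LeftReduced.
Variables (R : realType) (G : lcSemimultType).

(* The coefficient of delta_u in sum_(t, s t defined) f_t delta_(s t).  By left
   cancellation the sum has at most one term. *)
Definition lam_fun (s : G) (f : G -> R[i]) (u : G) : R[i] :=
  \sum_(t \in [set t | pmul s t = Some u]) f t.

Lemma lam_fun_def (s t u : G) (f : G -> R[i]) :
  pmul s t = Some u -> lam_fun s f u = f t.
Proof.
move=> st; rewrite /lam_fun (_ : [set _ | _] = [set t]) ?fsbig_set1 //.
by apply/seteqP; split=> [t' /= st'|_ ->] //; exact: pmulI st' st.
Qed.

Lemma lam_fun_undef (s u : G) (f : G -> R[i]) :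
  (forall t, pmul s t <> Some u) -> lam_fun s f u = 0.
Proof.
move=> st; rewrite /lam_fun (_ : [set _ | _] = set0) ?fsbig_set0 //.
by apply/seteqP; split=> [t' /st|].
Qed.

Lemma lam_fun_ell2 (s : G) (f : ell2 R G) :
  lam_fun s f \in @square_summable R G.
Proof.
have := ell2P f; rewrite !unfold_in; apply: le_lt_trans; rewrite /sqsum.
pose D := [set t : G | exists u, pmul s t = Some u].
pose e t := odflt t (pmul s t).
have injD : set_inj D e.
  move=> t1 t2; rewrite !inE => -[u1 st1] [u2 st2].
  rewrite /e st1 st2 /= => u12; rewrite u12 in st1.
  exact: pmulI st1 st2.
rewrite [leLHS](_ : _ = \esum_(u in e @` D) (normc (lam_fun s f u) ^+ 2)%:E).
  rewrite esum_image // [leRHS](esumID D) ?setTI; last first.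
    by move=> t _; rewrite lee_fin sqr_ge0.
  rewrite -[leLHS]adde0; apply: leeD; last first.
    by apply: esum_ge0 => t _; rewrite lee_fin sqr_ge0.
  apply: le_esum => t [u st]; rewrite /e st /= lee_fin.
  by rewrite (lam_fun_def _ st).
rewrite [RHS]esum_mkcond; apply: eq_esum => u _.
case: ifPn => // /negP uD; rewrite lam_fun_undef ?normc0 ?expr0n // => t st.
by apply: uD; rewrite inE; exists t; [exists u | rewrite /e st].
Qed.

Definition lam (s : G) (f : ell2 R G) : ell2 R G := Ell2 (lam_fun_ell2 s f).

Definition Cstar_red : set (ell2 R G -> ell2 R G) :=
  smallest (@sub_cstar_algebra R G) (range lam).

End LeftReduced.

Arguments lam R {G} s f.
Arguments Cstar_red R G _ : clear implicits.

(* Main.v *)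
(* [T] acts on [ell^2(Delta)] by partial bijections of the basis, so every
   relation of the semigraph algebra is an identity between partial bijections
   of [Delta], read off from associativity and left cancellation.  The only
   substantial one is relation (vi): if x t = y s in [Delta], unique
   factorisation of the [T]-part of x t at degree d(x) \/ d(y) gives exactly one
   (e, f) in [Tmin x y] with t = e w and s = f w; when t is a generator
   y' mu_alpha, the remainder w mu_alpha is again in [Delta] because
   w <= e w <= alpha_i. *)
Require Import Defs.
From HB Require Import structures.
From mathcomp Require Import all_boot all_order all_algebra.
From mathcomp Require Import complex lra.
From mathcomp Require Import boolp classical_sets functions cardinality fsbigop.
From mathcomp Require Import reals constructive_ereal ereal numfun esum.

Set Implicit Arguments.
Unset Strict Implicit.
Unset Printing Implicit Defensive.

Import Order.TTheory GRing.Theory Num.Theory.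
Import ComplexField.Normc.
Local Open Scope complex_scope.
Local Open Scope ring_scope.
Local Open Scope classical_set_scope.

Section Sums.
Variables (R : realType) (I : choiceType).
Implicit Types (h : I -> R).

Lemma rsumB (p q : I -> R) :
  (forall i, 0 <= p i) -> (forall i, 0 <= q i) ->
  summable [set: I] (EFin \o p) -> summable [set: I] (EFin \o q) ->
  rsum (p \- q) = fine (\esum_(i in [set: I]) (p i)%:E) -
                  fine (\esum_(i in [set: I]) (q i)%:E).
Proof.
move=> p0 q0 sp sq.
have fin (h : I -> R) : (forall i, 0 <= h i) ->
    summable [set: I] (EFin \o h) ->
    (\esum_(i in [set: I]) (h i)%:E)%E \is a fin_num.
  move=> h0; rewrite summableE; congr (_ \is a fin_num).
  by apply: eq_esum => i _ /=; rewrite ger0_norm.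
have fin' (h : I -> \bar R) : summable [set: I] h -> (forall i, 0 <= h i)%E ->
    (\esum_(i in [set: I]) h i)%E \is a fin_num.
  move=> + h0; rewrite summableE; congr (_ \is a fin_num).
  by apply: eq_esum => i _ /=; rewrite gee0_abs.
have spq : summable [set: I] (EFin \o (p \- q)) by exact: (summableB sp sq).
have e := @esumB _ _ [set: I] _ _ sp sq (fun i _ => p0 i) (fun i _ => q0 i).
rewrite /rsum -!fineB ?fin //.
- by rewrite -[in RHS]e.
- by apply: fin' => //; exact: summable_funepos.
- by apply: fin' => //; exact: summable_funeneg.
Qed.

Lemma rsumD h1 h2 :
  summable [set: I] (EFin \o h1) -> summable [set: I] (EFin \o h2) ->
  rsum (h1 \+ h2) = rsum h1 + rsum h2.
Proof.
pose pos h i := Num.max (h i) 0; pose neg h i := Num.max (- h i) 0.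
have pos0 h i : 0 <= pos h i by rewrite le_max lexx orbT.
have neg0 h i : 0 <= neg h i by rewrite le_max lexx orbT.
have hE h : h = pos h \- neg h.
  apply/funext => i; rewrite /pos /neg /=.
  by case: (leP (h i) 0) => hi; case: (leP (- h i) 0) => nhi; lra.
have spos h : summable [set: I] (EFin \o h) -> summable [set: I] (EFin \o pos h).
  apply: le_lt_trans; apply: le_esum => i _ /=; rewrite lee_fin /pos.
  by case: (leP (h i) 0); rewrite ?normr0.
have sneg h : summable [set: I] (EFin \o h) -> summable [set: I] (EFin \o neg h).
  apply: le_lt_trans; apply: le_esum => i _ /=; rewrite lee_fin /neg.
  by case: (leP (- h i) 0); rewrite ?normr0 ?normrN.
have nD (p q : I -> R) : (forall i, 0 <= p i) -> (forall i, 0 <= q i) ->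
    summable [set: I] (EFin \o p) -> summable [set: I] (EFin \o q) ->
    fine (\esum_(i in [set: I]) (p i + q i)%:E) =
    fine (\esum_(i in [set: I]) (p i)%:E) + fine (\esum_(i in [set: I]) (q i)%:E).
  move=> p0 q0 sp sq.
  under eq_esum do rewrite EFinD.
  rewrite esumD; [|by move=> i _; rewrite lee_fin..].
  rewrite fineD //; [move: sp|move: sq]; rewrite summableE;
    congr (_ \is a fin_num); apply: eq_esum => i _ /=; by rewrite ger0_norm.
move=> s1 s2.
have -> : h1 \+ h2 = (fun i => pos h1 i + pos h2 i) \- (fun i => neg h1 i + neg h2 i).
  by apply/funext => i; rewrite {1}(hE h1) {1}(hE h2) /=; lra.
rewrite rsumB; first 1 last.
- by move=> i; rewrite addr_ge0.
- by move=> i; rewrite addr_ge0.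
- exact: (summableD (spos _ s1) (spos _ s2)).
- exact: (summableD (sneg _ s1) (sneg _ s2)).
rewrite (nD (pos h1) (pos h2)) ?(nD (neg h1) (neg h2)) //;
  try by [exact: spos | exact: sneg].
rewrite [in RHS](hE h1) [in RHS](hE h2).
rewrite (@rsumB (pos h1)) ?(@rsumB (pos h2)) //; try by [exact: spos|exact: sneg].
by rewrite opprD addrACA.
Qed.

Lemma csumD (h1 h2 : I -> R[i]) :
  (forall h : I -> R[i], h = h1 \/ h = h2 ->
     summable [set: I] (EFin \o (fun i => complex.Re (h i))) /\
     summable [set: I] (EFin \o (fun i => complex.Im (h i)))) ->
  csum (h1 \+ h2) = csum h1 + csum h2.
Proof.
move=> s; have [r1 i1] := s _ (or_introl erefl).
have [r2 i2] := s _ (or_intror erefl).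
have ReD : (fun i => complex.Re ((h1 \+ h2) i)) =
    (fun i => complex.Re (h1 i)) \+ (fun i => complex.Re (h2 i)).
  by apply/funext => i /=; case: (h1 i) (h2 i) => [? ?] [? ?].
have ImD : (fun i => complex.Im ((h1 \+ h2) i)) =
    (fun i => complex.Im (h1 i)) \+ (fun i => complex.Im (h2 i)).
  by apply/funext => i /=; case: (h1 i) (h2 i) => [? ?] [? ?].
by rewrite /csum ReD ImD !rsumD.
Qed.

Lemma rsum_single h i0 : (forall i, i != i0 -> h i = 0) -> rsum h = h i0.
Proof.
move=> h0.
have single (F : I -> \bar R) : (forall i, 0 <= F i)%E ->
    (forall i, i != i0 -> F i = 0%E) -> (\esum_(i in [set: I]) F i)%E = F i0.
  move=> F0 Fi; rewrite -[RHS]esum_set1 // [RHS]esum_mkcond.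
  apply: eq_esum => i _; case: ifPn => //; rewrite notin_setE => /= ii0.
  by apply: Fi; apply/eqP.
rewrite /rsum !single //=.
- rewrite funeposE funenegE /=; case: (leP (h i0) 0) => hi.
    by rewrite (max_idPr _) ?lee_fin // (max_idPl _) ?lee_fin ?oppr_ge0 //= sub0r opprK.
  by rewrite (max_idPl _) ?lee_fin ?ltW // (max_idPr _) ?lee_fin ?oppr_le0 ?ltW //= subr0.
- by move=> i /h0 e; rewrite funenegE /= e oppr0 maxxx.
- by move=> i /h0 e; rewrite funeposE /= e maxxx.
Qed.

Lemma csum_single (h : I -> R[i]) i0 :
  (forall i, i != i0 -> h i = 0) -> csum h = h i0.
Proof.
move=> h0; rewrite /csum !(rsum_single (i0 := i0)); first by case: (h i0).
all: by move=> i /h0 ->.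
Qed.

End Sums.

Section Inner.
Variables (R : realType) (G : choiceType).
Implicit Types (f g : ell2 R G).

Lemma ell2_ext f g : (forall u, f u = g u) -> f = g.
Proof. by move=> fg; apply/val_inj/funext. Qed.

Lemma summable_bilinear f g :
  let h t := f t * (g t)^* in
  summable [set: G] (EFin \o (fun t => complex.Re (h t))) /\
  summable [set: G] (EFin \o (fun t => complex.Im (h t))).
Proof.
have fg : (\esum_(t in [set: G]) (normc (f t) ^+ 2)%:E +
           \esum_(t in [set: G]) (normc (g t) ^+ 2)%:E < +oo)%E.
  by apply: lte_add_pinfty; [have := ell2P f | have := ell2P g].
rewrite -esumD in fg; [|by move=> t _; rewrite lee_fin sqr_ge0..].
split; apply: le_lt_trans fg; apply: le_esum => t _ /=; rewrite -EFinD lee_fin.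
all: case: (f t) (g t) => [a b] [c d] /=.
all: rewrite !sqr_sqrtr ?addr_ge0 ?sqr_ge0 // ler_norml.
all: have := sqr_ge0 (a + c); have := sqr_ge0 (a - c).
all: have := sqr_ge0 (b + d); have := sqr_ge0 (b - d).
all: have := sqr_ge0 (a + d); have := sqr_ge0 (a - d).
all: have := sqr_ge0 (b + c); have := sqr_ge0 (b - c).
all: by rewrite !sqrrD !sqrrN; move=> *; apply/andP; split; lra.
Qed.

Lemma innerDl f1 f2 g : inner (f1 + f2) g = inner f1 g + inner f2 g.
Proof.
rewrite /inner -csumD; last by move=> h [] ->; exact: summable_bilinear.
by congr csum; apply/funext => t /=; rewrite mulrDl.
Qed.

Lemma innerDr f g1 g2 : inner f (g1 + g2) = inner f g1 + inner f g2.
Proof.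
rewrite /inner -csumD; last by move=> h [] ->; exact: summable_bilinear.
by congr csum; apply/funext => t /=; rewrite rmorphD mulrDr.
Qed.

Lemma inner_scale (c : R[i]) f g : inner (c *: f) g = inner f (c^* *: g).
Proof.
rewrite /inner; congr csum; apply/funext => t /=.
by rewrite rmorphM /= conjCK mulrCA mulrA.
Qed.

Lemma delta_square_summable (u : G) :
  (fun t => (t == u)%:R : R[i]) \in @square_summable R G.
Proof.
rewrite unfold_in /sqsum.
suff -> : (\esum_(t in [set: G]) (normc ((t == u)%:R : R[i]) ^+ 2)%:E)%E = 1%E.
  by rewrite ltry.
rewrite -[RHS](@esum_set1 R G u (fun=> 1%E)) // [RHS]esum_mkcond.
apply: eq_esum => t _; case: ifPn; rewrite ?inE ?notin_setE /=.
  by move=> ->; rewrite eqxx /= expr0n addr0 expr1n sqrtr1 expr1n.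
by move/eqP/negbTE => -> /=; rewrite expr0n addr0 sqrtr0 expr0n.
Qed.

Definition ell2_delta (u : G) : ell2 R G := Ell2 (delta_square_summable u).

Lemma inner_delta (u : G) g : inner (ell2_delta u) g = (g u)^*.
Proof.
rewrite /inner (csum_single (i0 := u)) /= ?eqxx ?mul1r // => t /negbTE ->.
by rewrite mul0r.
Qed.

Lemma adjoint_unique (A B1 B2 : ell2 R G -> ell2 R G) :
  is_adjoint A B1 -> is_adjoint A B2 -> B1 = B2.
Proof.
move=> AB1 AB2; apply/funext => g; apply: ell2_ext => u.
by rewrite -[LHS]conjCK -inner_delta -AB1 AB2 inner_delta conjCK.
Qed.

End Inner.

Section Adjointable.
Variables (R : realType) (G : choiceType).
Local Notation H := (ell2 R G).

(* Carrying the adjoint along with the operator makes the involution total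
   without appealing to the Riesz representation theorem. *)
Record adjointable : Type := Adjointable {
  op : H -> H;
  adj : H -> H;
  op_linear : linear op;
  adj_linear : linear adj;
  op_adj : is_adjoint op adj;
  adj_op : is_adjoint adj op
}.
HB.instance Definition _ := gen_eqMixin adjointable.
HB.instance Definition _ := gen_choiceMixin adjointable.

Lemma op_inj : injective op.
Proof.
move=> [A A' lA lA' AA' A'A] [B B' lB lB' BB' B'B] /= AB.
move: lB BB' B'B; rewrite -AB => lB BB' B'B.
have AB' := adjoint_unique AA' BB'.
move: lB' BB' B'B; rewrite -AB' => lB' BB' B'B.
by congr Adjointable; exact: Prop_irrelevance.
Qed.

Lemma linear_cst0 : linear (0 : H -> H).
Proof. by move=> c f g; change (0 = c *: (0 : H) + 0); rewrite scaler0 addr0. Qed.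

Lemma adjoint_cst0 : is_adjoint (0 : H -> H) 0.
Proof.
move=> f g; rewrite /inner; congr csum; apply/funext => t.
change (0 * (g t)^* = f t * 0^*); by rewrite rmorph0 mul0r mulr0.
Qed.

Definition adjointable0 :=
  Adjointable linear_cst0 linear_cst0 adjoint_cst0 adjoint_cst0.

Lemma linear_fctD (A B : H -> H) : linear A -> linear B -> linear (A + B).
Proof. by move=> lA lB c f g; rewrite !fctE lA lB scalerDr addrACA. Qed.

Lemma adjointD (A A' B B' : H -> H) :
  is_adjoint A A' -> is_adjoint B B' -> is_adjoint (A + B) (A' + B').
Proof. by move=> AA BB f g; rewrite !fctE innerDl innerDr AA BB. Qed.

Definition adjointableD (a b : adjointable) := Adjointable
  (linear_fctD (op_linear a) (op_linear b))
  (linear_fctD (adj_linear a) (adj_linear b))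
  (adjointD (op_adj a) (op_adj b)) (adjointD (adj_op a) (adj_op b)).

Lemma linear_fctZ (c : R[i]) (A : H -> H) : linear A -> linear (c *: A).
Proof.
by move=> lA d f g; rewrite !fctE lA scalerDr !scalerA [c * d]mulrC.
Qed.

Lemma linear_fun0 (A : H -> H) : linear A -> A 0 = 0.
Proof. by move=> lA; have := lA (-1) 0 0; rewrite scaler0 addr0 scaleN1r addNr. Qed.

Lemma linear_funZ (A : H -> H) (c : R[i]) (f : H) :
  linear A -> A (c *: f) = c *: A f.
Proof. by move=> lA; rewrite -[c *: f]addr0 lA linear_fun0 // addr0. Qed.

Lemma linear_funD (A : H -> H) (f g : H) : linear A -> A (f + g) = A f + A g.
Proof. by move=> lA; rewrite -{1}[f]scale1r lA scale1r. Qed.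

(* Moving [c] into the argument by linearity of [A] avoids proving that [inner]
   is homogeneous. *)
Lemma adjointZ (c : R[i]) (A A' : H -> H) :
  linear A -> is_adjoint A A' -> is_adjoint (c *: A) (c^* *: A').
Proof.
by move=> lA AA f g; rewrite !fctE -linear_funZ // AA inner_scale.
Qed.

Lemma adjointZV (c : R[i]) (A A' : H -> H) :
  linear A' -> is_adjoint A' A -> is_adjoint (c^* *: A') (c *: A).
Proof. by move=> lA AA; rewrite -{2}(conjCK c); exact: adjointZ. Qed.

Definition adjointableZ (c : R[i]) (a : adjointable) := Adjointable
  (linear_fctZ c (op_linear a)) (linear_fctZ c^* (adj_linear a))
  (adjointZ c (op_linear a) (op_adj a)) (adjointZV c (adj_linear a) (adj_op a)).

Lemma linear_funcomp (A B : H -> H) : linear A -> linear B -> linear (A \o B).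
Proof. by move=> lA lB c f g; rewrite /= lB lA. Qed.

Lemma adjointM (A A' B B' : H -> H) :
  is_adjoint A A' -> is_adjoint B B' -> is_adjoint (A \o B) (B' \o A').
Proof. by move=> AA BB f g; rewrite /= AA BB. Qed.

Definition adjointableM (a b : adjointable) := Adjointable
  (linear_funcomp (op_linear a) (op_linear b))
  (linear_funcomp (adj_linear b) (adj_linear a))
  (adjointM (op_adj a) (op_adj b)) (adjointM (adj_op b) (adj_op a)).

Definition adjointable_star (a : adjointable) := Adjointable
  (adj_linear a) (op_linear a) (adj_op a) (op_adj a).

Let addA : associative adjointableD.
Proof. by move=> a b c; apply: op_inj; exact: addrA. Qed.
Let addC : commutative adjointableD.
Proof. by move=> a b; apply: op_inj; exact: addrC. Qed.
Let add0 : left_id adjointable0 adjointableD.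
Proof. by move=> a; apply: op_inj; exact: add0r. Qed.
Let addN : left_inverse adjointable0 (adjointableZ (-1)) adjointableD.
Proof.
by move=> a; apply: op_inj; rewrite /= -[X in _ + X]scale1r -scalerDl addNr scale0r.
Qed.

HB.instance Definition _ := GRing.isZmodule.Build adjointable addA addC add0 addN.

Let scaleA (c d : R[i]) (a : adjointable) :
  adjointableZ c (adjointableZ d a) = adjointableZ (c * d) a.
Proof. by apply: op_inj; exact: scalerA. Qed.
Let scale1 : left_id 1 adjointableZ.
Proof. by move=> a; apply: op_inj; exact: scale1r. Qed.
Let scaleDr : right_distributive adjointableZ +%R.
Proof. by move=> c a b; apply: op_inj; exact: scalerDr. Qed.
Let scaleDl (a : adjointable) :
  {morph adjointableZ^~ a : c d / c + d >-> c + d}.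
Proof. by move=> c d; apply: op_inj; exact: scalerDl. Qed.

HB.instance Definition _ := GRing.Zmodule_isLmodule.Build R[i] adjointable
  scaleA scale1 scaleDr scaleDl.

Let mulA (a b c : adjointable) :
  adjointableM a (adjointableM b c) = adjointableM (adjointableM a b) c.
Proof. exact: op_inj. Qed.
Let mulDl (a b c : adjointable) :
  adjointableM (a + b) c = adjointableM a c + adjointableM b c.
Proof. exact: op_inj. Qed.
Let mulDr (a b c : adjointable) :
  adjointableM a (b + c) = adjointableM a b + adjointableM a c.
Proof. by apply: op_inj; apply/funext => f; exact/linear_funD/op_linear. Qed.
Let mulZl (x : R[i]) (a b : adjointable) :
  adjointableM (x *: a) b = x *: adjointableM a b.
Proof. exact: op_inj. Qed.
Let mulZr (x : R[i]) (a b : adjointable) :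
  adjointableM a (x *: b) = x *: adjointableM a b.
Proof. by apply: op_inj; apply/funext => f; exact/linear_funZ/op_linear. Qed.
Let starK_ (a : adjointable) : adjointable_star (adjointable_star a) = a.
Proof. exact: op_inj. Qed.
Let starD_ (a b : adjointable) :
  adjointable_star (a + b) = adjointable_star a + adjointable_star b.
Proof. exact: op_inj. Qed.
Let starZ_ (c : R[i]) (a : adjointable) :
  adjointable_star (c *: a) = c^* *: adjointable_star a.
Proof. exact: op_inj. Qed.
Let starM_ (a b : adjointable) : adjointable_star (adjointableM a b) =
  adjointableM (adjointable_star b) (adjointable_star a).
Proof. exact: op_inj. Qed.

HB.instance Definition _ := isStarAlgebra.Build R adjointable
  mulA mulDl mulDr mulZl mulZr starK_ starD_ starZ_ starM_.

Lemma adjointable_representation (X : starAlgType R) (f : X -> adjointable) :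
  star_morphism f -> star_representation (fun x => op (f x)).
Proof.
move=> [flin fM fS]; split=> [c x y|x y|x].
- by rewrite flin.
- by rewrite fM.
- by rewrite fS; exact: op_adj.
Qed.

End Adjointable.

Section PartialBijections.
Variables (R : realType) (G : choiceType).

Definition partial_inverse (p q : G -> option G) : Prop :=
  forall u t, p u = Some t <-> q t = Some u.

Lemma partial_inverseC (p q : G -> option G) :
  partial_inverse p q -> partial_inverse q p.
Proof. by move=> pq u t; split=> /pq. Qed.

Lemma esum_partial (p q : G -> option G) (F : G -> G -> \bar R) :
  partial_inverse p q ->
  (\esum_(u in [set: G]) oapp (F u) 0 (p u))%E =
  (\esum_(t in [set: G]) oapp (F^~ t) 0 (q t))%E.
Proof.
move=> pq.
have dom (r : G -> option G) (F' : G -> G -> \bar R) :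
    (\esum_(u in [set: G]) oapp (F' u) 0 (r u))%E =
    (\esum_(u in [set u | isSome (r u)]) oapp (F' u) 0 (r u))%E.
  rewrite [RHS]esum_mkcond; apply: eq_esum => u _.
  by case: ifPn => //; rewrite notin_setE /=; case: (r u).
rewrite (dom p) (dom q (fun t => F^~ t)).
rewrite [RHS](@reindex_esum _ _ _ [set u | isSome (p u)]
  [set t | isSome (q t)] (fun u => odflt u (p u))).
  apply: eq_esum => u /=; case E: (p u) => [t|] //= _.
  by rewrite (proj1 (pq u t) E).
split.
- move=> u /=; case E: (p u) => [t|] //= _.
  by rewrite (proj1 (pq u t) E).
- move=> u u'; rewrite !inE /=.
  case E: (p u) => [t|] //= _; case E': (p u') => [t'|] //= _ tt'.
  move: E'; rewrite -tt'; move: E => /pq E /pq E'.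
  by move: E'; rewrite E => -[].
- move=> t /=; case E: (q t) => [u|] //= _.
  by exists u; rewrite /= (proj2 (pq u t) E).
Qed.

Lemma csum_partial (p q : G -> option G) (h : G -> G -> R[i]) :
  partial_inverse p q ->
  csum (fun u => oapp (h u) 0 (p u)) = csum (fun t => oapp (h^~ t) 0 (q t)).
Proof.
move=> pq.
have rsumE (h' : G -> G -> R) :
    rsum (fun u => oapp (h' u) 0 (p u)) = rsum (fun t => oapp (h'^~ t) 0 (q t)).
  rewrite /rsum; congr (fine _ - fine _).
    transitivity (\esum_(u in [set: G])
        oapp (fun t => maxe (h' u t)%:E 0) 0 (p u))%E.
      apply: eq_esum => u _; rewrite funeposE /=.
      by case: (p u) => //=; rewrite maxxx.
    rewrite (esum_partial _ pq); apply: eq_esum => t _; rewrite funeposE /=.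
    by case: (q t) => //=; rewrite maxxx.
  transitivity (\esum_(u in [set: G])
      oapp (fun t => maxe (- (h' u t)%:E) 0) 0 (p u))%E.
    apply: eq_esum => u _; rewrite funenegE /=.
    by case: (p u) => //=; rewrite oppr0 maxxx.
  rewrite (esum_partial _ pq); apply: eq_esum => t _; rewrite funenegE /=.
  by case: (q t) => //=; rewrite oppr0 maxxx.
rewrite /csum; congr (_ +i* _)%C.
  transitivity (rsum (fun u => oapp (fun t => complex.Re (h u t)) 0 (p u))).
    by congr rsum; apply/funext => u; case: (p u).
  by rewrite (rsumE (fun u t => complex.Re (h u t))); congr rsum;
    apply/funext => t; case: (q t).
transitivity (rsum (fun u => oapp (fun t => complex.Im (h u t)) 0 (p u))).
  by congr rsum; apply/funext => u; case: (p u).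
by rewrite (rsumE (fun u t => complex.Im (h u t))); congr rsum;
    apply/funext => t; case: (q t).
Qed.

Section Pull.
Variables (p q : G -> option G) (pq : partial_inverse p q).

Definition pull_fun (f : G -> R[i]) (u : G) : R[i] := oapp f 0 (p u).

Lemma sqsum_pull (f : G -> R[i]) : (sqsum (pull_fun f) <= sqsum f)%E.
Proof.
rewrite /sqsum [leLHS](_ : _ =
  \esum_(u in [set: G]) oapp (fun t => (normc (f t) ^+ 2)%:E) 0%E (p u)).
  rewrite (esum_partial (fun _ t => (normc (f t) ^+ 2)%:E) pq).
  apply: le_esum => t _.
  by case: (q t) => [u|] //=; rewrite lee_fin sqr_ge0.
apply: eq_esum => u _; rewrite /pull_fun.
case: (p u) => //; rewrite -[LHS]/((normc (0 : R[i]) ^+ 2)%:E).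
by rewrite normc0 expr0n.
Qed.

Lemma pull_square_summable (f : ell2 R G) :
  pull_fun f \in @square_summable R G.
Proof.
rewrite unfold_in; apply: le_lt_trans (sqsum_pull f) _; exact: (ell2P f).
Qed.

Definition pull (f : ell2 R G) : ell2 R G := Ell2 (pull_square_summable f).

Lemma pull_linear : linear pull.
Proof.
move=> c f g; apply: ell2_ext => u /=; rewrite /pull_fun.
rewrite -[RHS]/(c * oapp f 0 (p u) + oapp g 0 (p u)).
by case: (p u) => //=; rewrite mulr0 addr0.
Qed.

Lemma pull_bounded : bounded_op pull.
Proof.
split; first exact: pull_linear.
exists 1 => f; rewrite mul1r /l2norm ler_wsqrtr // fine_le //.
- rewrite ge0_fin_numE; first exact: (ell2P (pull f)).
  by apply: esum_ge0 => t _; rewrite lee_fin sqr_ge0.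
- rewrite ge0_fin_numE; first exact: (ell2P f).
  by apply: esum_ge0 => t _; rewrite lee_fin sqr_ge0.
- exact: sqsum_pull.
Qed.

End Pull.

Lemma pull_adjoint (p q : G -> option G) (pq : partial_inverse p q)
    (qp : partial_inverse q p) : is_adjoint (pull pq) (pull qp).
Proof.
move=> f g; rewrite /inner.
transitivity (csum (fun u => oapp (fun t => f t * (g u)^*) 0 (p u))).
  congr csum; apply/funext => u; rewrite /= /pull_fun.
  by case: (p u) => //=; rewrite mul0r.
rewrite (csum_partial (fun u t => f t * (g u)^*) pq); congr csum.
apply/funext => t; rewrite /= /pull_fun.
by case: (q t) => //=; rewrite rmorph0 mulr0.
Qed.

End PartialBijections.

Section LeftRegular.
Variables (R : realType) (G : lcSemimultType).

Definition ldiv (s u : G) : option G :=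
  if pselect (exists t, pmul s t = Some u) is left e then Some (projT1 (cid e))
  else None.

Lemma ldivP (s : G) : partial_inverse (ldiv s) (pmul s).
Proof.
move=> u t; rewrite /ldiv; case: pselect => [e|ne]; last first.
  by split=> // st; case: ne; exists t.
split=> [[<-]|st]; first by case: (cid e).
by congr Some; case: (cid e) => t' /= st'; exact: pmulI st' st.
Qed.

Lemma pmul_ldivP (s : G) : partial_inverse (pmul s) (ldiv s).
Proof. exact/partial_inverseC/ldivP. Qed.

Lemma lam_pull (s : G) : lam R s = pull (ldivP s).
Proof.
apply/funext => f; apply: ell2_ext => u; rewrite /= /pull_fun.
case E: (ldiv s u) => [t|] /=; first by rewrite (lam_fun_def _ (proj1 (ldivP s u t) E)).
by apply: lam_fun_undef => t /ldivP; rewrite E.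
Qed.

Definition lam_adjointable (s : G) : adjointable R G := Adjointable
  (pull_linear (ldivP s)) (pull_linear (pmul_ldivP s))
  (pull_adjoint (ldivP s) (pmul_ldivP s)) (pull_adjoint (pmul_ldivP s) (ldivP s)).

Lemma op_lam_adjointable (s : G) : op (lam_adjointable s) = lam R s.
Proof. by rewrite lam_pull. Qed.

Lemma adjointable_ext (a b : adjointable R G) :
  (forall f u, op a f u = op b f u) -> a = b.
Proof.
by move=> ab; apply: op_inj; apply/funext => f; apply: ell2_ext => u.
Qed.

Lemma op_star_lam (s : G) (f : ell2 R G) (u : G) :
  op (star (lam_adjointable s)) f u = oapp f 0 (pmul s u).
Proof. by []. Qed.

Lemma op_lam (s : G) (f : ell2 R G) (u : G) :
  op (lam_adjointable s) f u = oapp f 0 (ldiv s u).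
Proof. by []. Qed.

Lemma opM (a b : adjointable R G) (f : ell2 R G) :
  op (a ** b) f = op a (op b f).
Proof. by []. Qed.

Lemma Cstar_red0 : Cstar_red R G 0.
Proof. by move=> S [[[_ S0 _ _ _] _] _]. Qed.

Lemma Cstar_redD (c : R[i]) A B :
  Cstar_red R G A -> Cstar_red R G B -> Cstar_red R G (c *: A + B).
Proof.
move=> CA CB S SP; case: (SP) => [[[_ _ SD _ _] _] _].
by apply: SD; [exact: CA | exact: CB].
Qed.

Lemma Cstar_redM A B :
  Cstar_red R G A -> Cstar_red R G B -> Cstar_red R G (A \o B).
Proof.
move=> CA CB S SP; case: (SP) => [[[_ _ _ SM _] _] _].
by apply: SM; [exact: CA | exact: CB].
Qed.

Lemma Cstar_red_lam s : Cstar_red R G (op (lam_adjointable s)).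
Proof. by rewrite op_lam_adjointable => S [_]; apply; exists s. Qed.

Lemma Cstar_red_lam_adj s : Cstar_red R G (adj (lam_adjointable s)).
Proof.
move=> S SP; case: (SP) => [[[_ _ _ _ SA] _] _].
apply: (SA (op (lam_adjointable s)) (adj (lam_adjointable s))).
- exact: Cstar_red_lam.
- exact: pull_bounded.
- exact: op_adj.
Qed.

Lemma Cstar_red_eval (I : Type) (j : I -> G) (x : star_term R I) :
  let a := star_eval (fun i => lam_adjointable (j i)) x in
  Cstar_red R G (op a) /\ Cstar_red R G (adj a).
Proof.
have CZ (c : R[i]) A : Cstar_red R G A -> Cstar_red R G (c *: A).
  by move=> CA; rewrite -[_ *: _]addr0; apply: Cstar_redD CA Cstar_red0.
have CD A B : Cstar_red R G A -> Cstar_red R G B -> Cstar_red R G (A + B).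
  by move=> CA CB; rewrite -[A]scale1r; exact: Cstar_redD.
elim: x => [i||x [? ?] y [? ?]|x [? ?]|c x [? ?]|x [? ?] y [? ?]|x [? ?]] /=.
- by split; [exact: Cstar_red_lam | exact: Cstar_red_lam_adj].
- by split; exact: Cstar_red0.
- by split; exact: CD.
- by split; exact: CZ.
- by split; exact: CZ.
- by split; exact: Cstar_redM.
- by [].
Qed.

End LeftRegular.

Section SemimultLemmas.
Variable G : semimultType.

Lemma pmul_assocr (s t u st v : G) : pmul s t = Some st -> pmul st u = Some v ->
  exists2 tu, pmul t u = Some tu & pmul s tu = Some v.
Proof.
move=> e1 e2; have := pmulA s t u; rewrite e1 /= e2.
by case: (pmul t u) => //= tu e; exists tu.
Qed.

Lemma pmul_assocl (s t u tu v : G) : pmul t u = Some tu -> pmul s tu = Some v ->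
  exists2 st, pmul s t = Some st & pmul st u = Some v.
Proof.
move=> e1 e2; have := pmulA s t u; rewrite e1 /= e2.
by case: (pmul s t) => //= st e; exists st.
Qed.

End SemimultLemmas.

Section LamRelations.
Variables (R : realType) (G : lcSemimultType).
Local Notation L := (@lam_adjointable R G).

Lemma pmul_ldiv (s t u : G) : pmul s t = Some u -> ldiv s u = Some t.
Proof. by move/ldivP. Qed.

Lemma ldiv_pmul (s t u : G) : ldiv s u = Some t -> pmul s t = Some u.
Proof. by move/ldivP. Qed.

Lemma ldiv_ldiv (x y u : G) : obind (ldiv y) (ldiv x u) =
  if pmul x y is Some z then ldiv z u else None.
Proof.
case E: (ldiv x u) => [v|] /=.
  case F: (ldiv y v) => [t|].
    have [z -> /pmul_ldiv -> //] := pmul_assocl (ldiv_pmul F) (ldiv_pmul E).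
  case P: (pmul x y) => [z|] //; case D: (ldiv z u) => [t|] //.
  have [w yt /pmul_ldiv] := pmul_assocr P (ldiv_pmul D).
  by rewrite E => -[vw]; rewrite -vw in yt; rewrite (pmul_ldiv yt) in F.
case P: (pmul x y) => [z|] //; case D: (ldiv z u) => [t|] //.
by have [w _ /pmul_ldiv] := pmul_assocr P (ldiv_pmul D); rewrite E.
Qed.

Lemma op_lamM (x y : G) (f : ell2 R G) (u : G) :
  op (L x ** L y) f u = oapp f 0 (obind (ldiv y) (ldiv x u)).
Proof. by rewrite opM op_lam; case: (ldiv x u). Qed.

Lemma lamM (x y z : G) : pmul x y = Some z -> L x ** L y = L z.
Proof.
by move=> xy; apply: adjointable_ext => f u; rewrite op_lamM ldiv_ldiv xy op_lam.
Qed.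

Lemma lamM0 (x y : G) : pmul x y = None -> L x ** L y = 0.
Proof. by move=> xy; apply: adjointable_ext => f u; rewrite op_lamM ldiv_ldiv xy. Qed.

Lemma op_source_proj (x : G) (f : ell2 R G) (u : G) :
  op (source_proj (L x)) f u = if pmul x u then f u else 0.
Proof.
rewrite opM op_star_lam; case E: (pmul x u) => [v|] //=.
by rewrite /pull_fun (pmul_ldiv E).
Qed.

Lemma lam_partial_isometry (x : G) : partial_isometry (L x).
Proof.
apply: adjointable_ext => f u; rewrite -smulA opM !op_lam.
case E: (ldiv x u) => [t|] //=.
by have := op_source_proj x f t; rewrite (ldiv_pmul E).
Qed.

Lemma source_projC (x y : G) : source_proj (L x) ** source_proj (L y) =
  source_proj (L y) ** source_proj (L x).
Proof.
apply: adjointable_ext => f u; rewrite !opM !op_source_proj.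
by case: (pmul x u); case: (pmul y u).
Qed.

Lemma lam_projection (e : G) : pmul e e = Some e -> projection (L e).
Proof.
move=> ee; split; first by rewrite (lamM ee).
have eI u v : pmul e u = Some v -> u = v.
  move=> eu; have [w ] := pmul_assocr ee eu; rewrite eu => -[<-] ev.
  exact: pmulI eu ev.
apply: adjointable_ext => f u; rewrite op_lam op_star_lam; congr oapp.
case E: (ldiv e u) => [t|].
  have et := ldiv_pmul E; have tu := eI _ _ et.
  by rewrite tu in et *; rewrite et.
case P: (pmul e u) => [v|] //; have uv := eI _ _ P; rewrite -uv in P.
by rewrite (pmul_ldiv P) in E.
Qed.

End LamRelations.

Section SemigraphLemmas.
Variables (k : Type) (T : semigraphType k).

Lemma factor_unique (a a' b b' z : T) :
  pmul a b = Some z -> pmul a' b' = Some z -> deg a = deg a' -> a = a'.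
Proof.
move=> ab ab' aa'.
have d := degM _ _ _ ab; have d' := degM _ _ _ ab'.
have bb' : deg b' = deg b.
  by apply/funext => i; have := congr1 (@^~ i) d; rewrite d' aa' => /addnI.
have [p [_ up]] := deg_factor _ _ _ d.
by have := up (a', b') (And3 ab' (esym aa') bb'); rewrite (up (a, b)) //; case.
Qed.

Lemma factor_through (x t z1 w z : T) :
  pmul x t = Some z -> pmul z1 w = Some z -> (forall i, deg x i <= deg z1 i)%N ->
  exists2 e, pmul x e = Some z1 & pmul e w = Some t.
Proof.
move=> xt zw le_x.
have d1 : deg z1 = (fun i => (deg x i + (deg z1 i - deg x i))%N).
  by apply/funext => i; rewrite subnKC.
have [[x' e] [[/= xe dx' _] _]] := deg_factor _ _ _ d1.
have [t' ew xt'] := pmul_assocr xe zw.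
have xx' := factor_unique xt' xt dx'.
rewrite xx' in xe xt'; exists e => //.
by rewrite ew (semigraph_pmulI xt xt').
Qed.

Lemma Tmin_factor (x y t s z : T) : pmul x t = Some z -> pmul y s = Some z ->
  exists e f v w, [/\ Tmin x y (e, f), pmul y f = Some v, pmul e w = Some t,
    pmul f w = Some s & pmul v w = Some z].
Proof.
move=> xt ys.
have d : deg z = (fun i => (maxn (deg x i) (deg y i) +
                           (deg z i - maxn (deg x i) (deg y i)))%N).
  apply/funext => i; rewrite subnKC // geq_max.
  by rewrite {1}(degM _ _ _ xt) {1}(degM _ _ _ ys) !leq_addr.
have [[v w] [[/= vw dv _] _]] := deg_factor _ _ _ d.
have [|e xe ew] := factor_through xt vw; first by move=> i; rewrite dv leq_maxl.
have [|f yf fw] := factor_through ys vw; first by move=> i; rewrite dv leq_maxr.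
by exists e, f, v, w; split=> //; exists v.
Qed.

Lemma Tmin_deg (x y : T) (p p' : T * T) :
  Tmin x y p -> Tmin x y p' -> deg p.1 = deg p'.1.
Proof.
move=> [z [xz _ dz]] [z' [xz' _ dz']]; apply/funext => i.
apply: (@addnI (deg x i)).
have /(congr1 (@^~ i)) /= <- := degM _ _ _ xz.
have /(congr1 (@^~ i)) /= <- := degM _ _ _ xz'.
by rewrite dz dz'.
Qed.

Lemma Tmin_inj (x y : T) (p p' : T * T) :
  Tmin x y p -> Tmin x y p' -> p.1 = p'.1 -> p = p'.
Proof.
case: p p' => [e f] [e' f'] [z [/= xz yz _]] [z' [/= xz' yz' _]] ee'.
rewrite ee' xz' in xz; case: xz => zz'; rewrite zz' in yz'.
by rewrite ee' (semigraph_pmulI yz yz').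
Qed.

End SemigraphLemmas.

Section DeltaLemmas.
Variables (k : Type) (T : semigraphType k).

Definition delta_base (u : delta T) : T :=
  match u with inl t => t | inr w => (val w).1 end.

Definition delta_tail (u : delta T) : option (seq T) :=
  match u with inl _ => None | inr w => Some (val w).2 end.

Lemma delta_pmulP (x : T) (w u : delta T) :
  pmul (to_delta x) w = Some u <->
  pmul x (delta_base w) = Some (delta_base u) /\ delta_tail w = delta_tail u.
Proof.
rewrite {1}/pmul /=; case: w u => [t|w] [t'|w'] /=.
- case: (pmul x t) => [z|] /=; last by split=> // -[].
  by split=> [[<-]//|[[<-]]].
- by case: (pmul x t) => [z|] /=; split=> // -[].
- case: (pmul x (val w).1) => [z|] /=; last by split=> // -[].
  by case: insub => [v|] /=; split=> // -[].
- case: (pmul x (val w).1) => [z|] /=; last by split=> // -[].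
  split=> [|[[zw] [ww]]]; first by case: insubP => //= v _ vE [<-]; rewrite vE.
  suff -> : (z, (val w).2) = val w' by rewrite valK.
  by rewrite zw ww -surjective_pairing.
Qed.

Lemma delta_lift (e w0 : T) (t : delta T) : pmul e w0 = Some (delta_base t) ->
  exists2 w : delta T, delta_base w = w0 & delta_tail w = delta_tail t.
Proof.
case: t => [t|w] /= ew; first by exists (inl w0).
suff wP : `[< exists2 a, a \in (val w).2 & sle w0 a >].
  by exists (inr (exist _ (w0, (val w).2) wP)).
have /asboolP[a aw [c ca]] := valP w; apply/asboolP; exists a => //.
by have [d _ da] := pmul_assocl ew ca; exists d.
Qed.

Lemma delta_Tmin_factor (x y : T) (t s u : delta T) :
  pmul (to_delta x) t = Some u -> pmul (to_delta y) s = Some u ->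
  exists e f v w, [/\ Tmin x y (e, f), pmul y f = Some v,
    pmul (to_delta e) w = Some t, pmul (to_delta f) w = Some s
    & pmul (to_delta v) w = Some u].
Proof.
move=> /delta_pmulP[xt tu] /delta_pmulP[ys su].
have [e [f [v [w0 [ef yf ew fw vw]]]]] := Tmin_factor xt ys.
have [w wE wt] := delta_lift ew; rewrite -wE in ew fw vw.
by exists e, f, v, w; split=> //; apply/delta_pmulP; rewrite wt // tu.
Qed.

End DeltaLemmas.

Section Representation.
Variables (R : realType) (k : Type) (T : semigraphType k).
Local Notation D := (delta T).

Definition lam_gen (t : T) : adjointable R D := lam_adjointable R (to_delta t).

Lemma op_sum (I : choiceType) (P : set I) (F : I -> adjointable R D)
    (f : ell2 R D) (u : D) : finite_set P ->
  op (\sum_(i \in P) F i) f u = \sum_(i \in P) op (F i) f u.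
Proof.
move=> finP; rewrite !fsbig_finite //.
exact: (big_morph (fun a : adjointable R D => op a f u)).
Qed.

Lemma star_lam_lam (x y : T) : finite_set (Tmin x y) ->
  star (lam_gen x) ** lam_gen y = \sum_(p \in Tmin x y)
    lam_gen p.1 ** source_proj (oapp lam_gen 0 (pmul y p.2)) **
    star (lam_gen p.2).
Proof.
move=> fin_xy; apply: adjointable_ext => f t; rewrite op_sum //.
have termE p v : pmul y p.2 = Some v ->
    op (lam_gen p.1 ** source_proj (oapp lam_gen 0 (pmul y p.2)) **
        star (lam_gen p.2)) f t =
    oapp (fun w => if pmul (to_delta v) w
                   then oapp f 0 (pmul (to_delta p.2) w) else 0)
      0 (ldiv (to_delta p.1) t).
  move=> ->; rewrite 2!opM op_lam [oapp lam_gen _ _]/=.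
  case: (ldiv _ t) => // w; rewrite [LHS]/(oapp _ _ _).
  by rewrite op_source_proj op_star_lam.
pose good (p : T * T) (v : T) (w u : D) := [/\ Tmin x y p, pmul y p.2 = Some v,
  pmul (to_delta p.1) w = Some t & pmul (to_delta v) w = Some u].
rewrite opM op_star_lam.
have [[p [v [w [u [pT yp pw vw]]]]]|ngood] := pselect (exists p v w u, good p v w u).
  rewrite (fsbigD1 p) // fsbig1 ?[RHS]addr0; last first.
    move=> p' [p'T p'p]; case: (p'T) => v' [_ yp' _].
    rewrite (termE _ _ yp'); case E: (ldiv _ t) => [w'|] //=; exfalso.
    apply/p'p/(Tmin_inj p'T pT).
    have /delta_pmulP[pw0 _] := pw.
    have /delta_pmulP[pw1 _] := ldiv_pmul E.
    exact: factor_unique pw1 pw0 (Tmin_deg p'T pT).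
  have [v1 [xp yp1 _]] := pT; rewrite yp in yp1; case: yp1 => vv1.
  rewrite -vv1 in xp => {v1 vv1}.
  have xpD : pmul (to_delta x) (to_delta p.1) = Some (to_delta v).
    by apply/delta_pmulP.
  have ypD : pmul (to_delta y) (to_delta p.2) = Some (to_delta v).
    by apply/delta_pmulP.
  have [t' pw' xt] := pmul_assocr xpD vw.
  move: pw'; rewrite pw => -[tt']; rewrite -tt' in xt.
  have [s ps ys] := pmul_assocr ypD vw.
  by rewrite (termE _ _ yp) xt (pmul_ldiv pw) /= vw ps /= /pull_fun (pmul_ldiv ys).
rewrite fsbig1 => [|p pT].
  case X: (pmul _ t) => [u|] //=; rewrite /pull_fun; case Y: (ldiv _ u) => [s|] //=.
  have [e [g [v [w [? ? ? ? ?]]]]] := delta_Tmin_factor X (ldiv_pmul Y).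
  by case: ngood; exists (e, g), v, w, u.
case: (pT) => v [_ yp _]; rewrite (termE _ _ yp).
case E: (ldiv _ t) => [w|] //=; case V: (pmul _ w) => [u|] //=.
by case: ngood; exists p, v, w, u; split=> //; exact: ldiv_pmul.
Qed.

Lemma lam_gen_relations :
  finitely_aligned T ->
  (forall t : T, degree_zero T t -> pmul t t = Some t) ->
  semigraph_relations lam_gen.
Proof.
move=> finT idemT; split; split.
- by move=> x; exact: lam_partial_isometry.
- move=> x /idemT xx; apply: lam_projection; exact/delta_pmulP.
- by move=> x y z xy; apply: lamM; apply/delta_pmulP.
- move=> x y xy; apply: lamM0.
  by case E: (pmul _ _) => [u|] //; have /delta_pmulP[] := E; rewrite xy.
- by move=> x y; exact: source_projC.
- by move=> x y; exact: star_lam_lam.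
Qed.

End Representation.

Theorem proposition4p8 (R : realType) (k : Type) (T : semigraphType k)
    (T_aligned : finitely_aligned T)
    (T0_idem : forall t : T, degree_zero T t -> pmul t t = Some t) :
  exists phi : semigraph_alg R T -> (ell2 R (delta T) -> ell2 R (delta T)),
    star_representation phi /\
    (forall x : semigraph_alg R T, Cstar_red R (delta T) (phi x)) /\
    (forall t : T, phi (semigraph_gen R t) = lam R (to_delta t)).
Proof.
have rel := @lam_gen_relations R k T T_aligned T0_idem.
exists (fun x => op (univ_lift (@lam_gen R k T) x)); split; [|split].
- exact: adjointable_representation (univ_lift_morphism rel).
- move=> x; exact: (proj1 (Cstar_red_eval (@to_delta k T) (repr x))).
- by move=> t; rewrite univ_lift_gen // op_lam_adjointable.
Qed.
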